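(* For any adaptive sampling and stopping rule and any adaptively chosen arm $\kappa$, and any adaptively rewound time $\tau \leq \mathcal{T}$ such that, for some deterministic time $t_0>0$ and a constant $b \geq 3$, $\tau\geq t_0$ and $N_k(t_0) \geq b$ almost surely (for all arms $k$), it holds that \[ \mathbb{E} \left[\frac{N_\kappa(\tau)}{\log\log N_\kappa(\tau)}\, D_{\psi^*_{\mu_{\kappa}}}\left(\hat{\mu}_{\kappa}(\tau), \mu_{\kappa} \right) \right] \leq C_b \left[I\left(\kappa;\mathcal{D}_{\mathcal{T}}\right) + 1.25\right], \] where $C_b := 4e\left(1 + \frac{1}{\log\log b}\right)$.
   Context: Stochastic multi-armed bandit with arms $P_1,\dots,P_{k^*}$ having finite means $\mu_k$. At each time $t$, an arm $A_t$ is drawn from a conditional distribution $\nu_t(\cdot\mid \mathcal{D}_{t-1})$ depending on past data $\mathcal{D}_{t-1}=\{W,A_1,Y_1,\dots,A_{t-1},Y_{t-1}\}$ ($W$ external randomness), and $Y_t\sim P_{A_t}$ independently; $\mathcal{F}_t=\sigma(W,A_1,Y_1,\dots,Y_t,A_{t+1})$. $N_k(t)=\sum_{s\le t}\mathbbm{1}(A_s=k)$, $S_k(t)=\sum_{s\le t}\mathbbm{1}(A_s=k)Y_s$, $\hat\mu_k(t)=S_k(t)/N_k(t)$. $\mathcal{T}$ is a stopping time w.r.t. $\{\mathcal{F}_t\}$, $\mathcal{D}_{\mathcal{T}}$ the collected data; the chosen arm $\kappa=\kappa(\mathcal{D}_{\mathcal{T}})$ and the rewound time $\tau\le\mathcal{T}$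 are $\mathcal{F}_{\mathcal{T}}$-measurable. $I(\kappa;\mathcal{D}_{\mathcal{T}})$ is the mutual information. Each arm is sub-$\psi$: $\log \mathbb{E}_{Y\sim P_k}[e^{\lambda(Y-\mu_k)}]\le\psi(\lambda)$ for all $\lambda\in\Lambda=(\lambda_{\min},\lambda_{\max})\ni 0$, where $\psi$ is nonnegative, twice continuously differentiable, strictly convex with $\psi(0)=\psi'(0)=0$. With $\psi_\mu(\lambda)=\lambda\mu+\psi(\lambda)$ and its convex conjugate $\psi_\mu^*(z)=\sup_{\lambda\in\Lambda}\lambda z-\psi_\mu(\lambda)$, the loss is the Bregman divergence $D_{\psi_\mu^*}(\hat\mu,\mu)=\psi_\mu^*(\hat\mu)-\psi_\mu^*(\mu)-\psi_\mu^{*\prime}(\mu)(\hat\mu-\mu)$ (which equals $\psi^*(\hat\mu-\mu)$). *)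

(* Defs.v *)
From HB Require Import structures.
From mathcomp Require Import all_boot all_order all_algebra.
From mathcomp Require Import all_classical all_reals all_analysis.
Set Implicit Arguments. Unset Strict Implicit. Unset Printing Implicit Defensive.
Import Order.TTheory GRing.Theory Num.Theory.
Import numFieldNormedType.Exports.
Local Open Scope classical_set_scope.
Local Open Scope ring_scope.

(* Rounds are indexed from 0: round s (s = 0,1,2,...) corresponds to the
   paper's time s+1.  "After t rounds" = paper's time t. *)

Section Bandit.
Context {R : realType} {dT dW : measure_display}
        {T : measurableType dT} {TW : measurableType dW} {K : nat}.
Variables (W : T -> TW) (A : nat -> T -> 'I_K) (Y : nat -> T -> R).

(* Generators of F_t = sigma(W, A_1, Y_1, ..., A_t, Y_t, A_{t+1}) (paper),
   i.e. W, arms of rounds s <= t, rewards of rounds s < t. *)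
Definition filt_gen (t : nat) : set (set T) :=
  [set E | (exists B : set TW, measurable B /\ E = W @^-1` B)
        \/ (exists (s : nat) (k : 'I_K), (s <= t)%N /\ E = [set w | A s w = k])
        \/ (exists (s : nat) (B : set R), (s < t)%N /\ measurable B /\
                                           E = Y s @^-1` B)].
Definition filt (t : nat) : set (set T) := <<s filt_gen t >>.

Definition data_gen (t : nat) : set (set T) :=
  [set E | (exists B : set TW, measurable B /\ E = W @^-1` B)
        \/ (exists (s : nat) (k : 'I_K), (s < t)%N /\ E = [set w | A s w = k])
        \/ (exists (s : nat) (B : set R), (s < t)%N /\ measurable B /\
                                           E = Y s @^-1` B)].
Definition data_sigma (t : nat) : set (set T) := <<s data_gen t >>.

Definition Ncount (k : 'I_K) (t : nat) (w : T) : R :=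
  \sum_(s < t) (A s w == k)%:R.
Definition Ssum (k : 'I_K) (t : nat) (w : T) : R :=
  \sum_(s < t) (A s w == k)%:R * Y s w.
Definition muhat (k : 'I_K) (t : nat) (w : T) : R := Ssum k t w / Ncount k t w.

(* Events of sigma(D_Tstop): their trace on {Tstop = t} is the trace of an
   event determined by the first t rounds of data. *)
Definition stopped_data_event (Tstop : T -> nat) (E : set T) : Prop :=
  forall t : nat, exists G, data_sigma t G /\
    E `&` [set w | Tstop w = t] = G `&` [set w | Tstop w = t].

Definition stopped_measurable_nat (Tstop X : T -> nat) : Prop :=
  forall t s : nat, filt t ([set w | Tstop w = t] `&` [set w | X w = s]).
Definition stopped_measurable_arm (Tstop : T -> nat) (X : T -> 'I_K) : Prop :=
  forall (t : nat) (k : 'I_K), filt t ([set w | Tstop w = t] `&` [set w | X w = k]).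

End Bandit.

Definition mi_term {R : realType} (pxy px py : R) : R :=
  if pxy == 0 then 0 else pxy * ln (pxy / (px * py)).

(* Mutual information I(kappa; G) between a finite-valued random variable
   kappa and the sigma-algebra of events G, defined (Gelfand-Yaglom-Perez /
   Dobrushin) as the supremum over finite G-measurable partitions (E_j) of
   the discrete mutual information between kappa and the partition index. *)
Definition mutual_info {R : realType} {d : measure_display} {T : measurableType d}
  {K : nat} (P : probability T R) (kappa : T -> 'I_K) (G : set T -> Prop) : \bar R :=
  ereal_sup [set x : \bar R | exists (n : nat) (E : 'I_n -> set T),
     (forall j, G (E j)) /\
     (forall i j, i != j -> E i `&` E j = set0) /\
     (forall w, exists j, E j w) /\
     x = (\sum_(k < K) \sum_(j < n)
            mi_term (fine (P ([set w | kappa w = k] `&` E j)))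
                    (fine (P [set w | kappa w = k])) (fine (P (E j))))%:E].

Definition in_Lam {R : realType} (lmin lmax : \bar R) (l : R) : Prop :=
  (lmin < l%:E)%E /\ (l%:E < lmax)%E.

Definition psi_mu {R : realType} (psi : R -> R) (mu l : R) : R := l * mu + psi l.
Definition psi_mu_star {R : realType} (psi : R -> R) (lmin lmax : \bar R) (mu z : R)
  : \bar R :=
  ereal_sup [set (l * z - psi_mu psi mu l)%:E | l in in_Lam lmin lmax].

Definition bregman_loss {R : realType} (psi : R -> R) (lmin lmax : \bar R) (muh mu : R)
  : \bar R :=
  (psi_mu_star psi lmin lmax mu muh - psi_mu_star psi lmin lmax mu mu
   - (derive1 (fun z => fine (psi_mu_star psi lmin lmax mu z)) mu * (muh - mu))%:E)%E.

(* Main.v *)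
(* Let psi* be the conjugate of psi on Lambda.  Strict convexity and psi >= 0 = psi(0) give
   psi*(z) = o(z) at 0, so the Bregman loss is psi*(muhat - mu).

   For fixed lambda, exp(lambda (S_k - mu_k N_k) - psi(lambda) N_k) is a supermartingale, so
   Ville's inequality bounds the probability that the loss of arm k ever exceeds c while
   N_k >= e^j by 2 exp(-c e^j).  Peeling over the epochs e^j <= N_k < e^(j+1), the event B_q^k
   that the normalized loss of arm k ever exceeds C_b q has probability at most 4 e^(-4q).
   Pointwise the integrand is at most C_b (1 + #{q >= 1 : B_q^kappa}), uniformly in tau.

   The Gibbs variational inequality, applied to the finite partition generated by finitely many
   B_q^k, bounds E[1 + #{q <= n : B_q^kappa}] by I(kappa; D_T) + log max_k E[e^(1 + #{q <= n : B_q^k})],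
   and the tail bound makes the logarithm at most 5/4.  Let n tend to infinity. *)
Require Import Defs.
From HB Require Import structures.
From mathcomp Require Import all_boot all_order all_algebra.
From mathcomp Require Import all_classical all_reals all_analysis.
From mathcomp Require Import measurable_realfun.
From mathcomp Require Import ring lra.
Import Order.TTheory GRing.Theory Num.Theory.
Import numFieldNormedType.Exports.
Local Open Scope classical_set_scope.
Local Open Scope ring_scope.

(** * Integration *)

Lemma measurable_superlevel (d : measure_display) (T : measurableType d)
  (R : realType) (f : T -> R) (c : R) :
  measurable_fun setT f -> measurable [set w | c <= f w].
Proof.
move=> mf; rewrite (_ : [set w | _] = setT `&` f @^-1` `[c, +oo[%classic).
  exact: (mf measurableT _ (measurable_itv _)).
by rewrite setTI; apply/seteqP; split => w; rewrite /= in_itv/= andbT.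
Qed.

Lemma measure_bigcup_le (d : measure_display) (T : measurableType d)
  (R : realType) (mu : {measure set T -> \bar R}) (F : nat -> set T) (q : \bar R) :
  (forall n, measurable (F n)) -> nondecreasing_seq F ->
  (forall n, mu (F n) <= q)%E -> (mu (\bigcup_n F n) <= q)%E.
Proof.
move=> mF ndF Fq; have mU := bigcup_measurable (fun n (_ : setT n) => mF n).
have h : (mu \o F) x @[x --> \oo] --> mu (\bigcup_n F n).
  exact: nondecreasing_cvg_mu.
rewrite -(cvg_lim _ h)//; apply: lime_le; first by apply/cvg_ex; exists (mu (\bigcup_n F n)).
by apply: nearW.
Qed.

(** No measurability is asked of [f], so this applies directly to the integrand of the theorem.
    Raising [g] to [+oo] on the exceptional null set makes the comparison pointwise without changing
    the integral of [g]. *)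
Lemma integral_le_ae (d : measure_display) (T : measurableType d)
  (R : realType) (mu : {measure set T -> \bar R}) (f g : T -> \bar R) :
  measurable_fun setT g -> (forall x, 0 <= g x)%E ->
  {ae mu, forall x, (f x <= g x)%E} -> (\int[mu]_x f x <= \int[mu]_x g x)%E.
Proof.
move=> mg g0 [N [mN N0 fN]].
pose h x := if x \in N then +oo%E else g x.
have mh : measurable_fun setT h.
  apply: measurable_fun_if => //.
  - by apply: (measurable_fun_bool true); rewrite setTI preimage_mem_true.
  - exact: measurable_funTS.
have h0 x : (0 <= h x)%E by rewrite /h; case: ifP.
have fh x : (f x <= h x)%E.
  rewrite /h; case: ifPn => [_|/negP xN]; first exact: leey.
  by apply/negP => /negP H; apply: xN; rewrite inE; apply: fN => /= H'; move/negP: H; rewrite H'.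
have -> : (\int[mu]_x g x = \int[mu]_x h x)%E.
  apply: ge0_ae_eq_integral => //; exists N; split => // x /= H.
  by apply: contrapT => xN; apply: H => _; rewrite /h memNset.
rewrite integralE [leRHS]ge0_integralE//.
have I0 : (0 <= \int[mu]_x f^\- x)%E by apply: integral_ge0 => x _; exact: funeneg_ge0.
apply: (@le_trans _ _ (\int[mu]_x f^\+ x)%E);  first by rewrite -[leRHS]sube0 leeB.
rewrite ge0_integralE//.
(* [\int f^\+] is a supremum over simple functions, monotone even for non-measurable [f]. *)
apply: le_ereal_sup => y /= [s sf <-]; exists s => //= x; apply: (le_trans (sf x)).
rewrite /patch; case: ifP => // _.
by rewrite funeposE ge_max fh h0.
Qed.

Lemma integral_mfrestr (d : measure_display) (T : measurableType d)
  (R : realType) (mu : {measure set T -> \bar R}) (F : set T) (mF : measurable F)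
  (Foo : (mu F < +oo)%E) (f : T -> \bar R) :
  measurable_fun setT f -> (forall x, 0 <= f x)%E ->
  (\int[mfrestr mF Foo]_x f x = \int[mu]_(x in F) f x)%E.
Proof.
move=> mf f0; rewrite (@ge0_negligible_integral _ _ _ _ setT (~` F))//.
- rewrite setTD setCK; apply: eq_measure_integral => A mA AF.
  by rewrite /= /mfrestr /mrestr setIidl.
- exact: measurableC.
- by rewrite /= /mfrestr /mrestr setICl measure0.
Qed.

(** The hypothesis on rectangles identifies the law of [(X, Y)] under [P] restricted to [F] with the
    product of the law of [X] and [Q]; Tonelli then factors the integral. *)
Lemma integral_mul_indep (d : measure_display) (T : measurableType d)
  (R : realType) (P : {finite_measure set T -> \bar R}) (Q : probability R R)
  (F : set T) (X Y h : T -> R) (g : R -> R) :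
  measurable F -> measurable_fun setT X -> measurable_fun setT Y ->
  measurable_fun setT g -> (forall w, 0 <= X w) -> (forall y, 0 <= g y) ->
  (forall B1 B2, measurable B1 -> measurable B2 ->
    P (F `&` X @^-1` B1 `&` Y @^-1` B2) = (P (F `&` X @^-1` B1) * Q B2)%E) ->
  (\int[P]_(w in F) (X w * g (Y w))%:E =
   \int[P]_(w in F) (X w)%:E * \int[Q]_y (g y)%:E)%E.
Proof.
move=> mF mX mY mg X0 g0 ind.
have Foo : (P F < +oo)%E by rewrite ltey_eq fin_num_measure.
pose mu : {finite_measure set T -> \bar R} := mfrestr mF Foo.
have mXY : measurable_fun setT (fun w => (X w, Y w)) by exact/measurable_fun_pair.
pose pX := measure_function_pushforward__canonical__measure_function_Measure mu mX.
have pXoo : (pX setT < +oo)%E by rewrite /= /pushforward preimage_setT ltey_eq fin_num_measure.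
(* [nu] is [pX] itself; restricting to the full set only equips it with the finite-measure structure
   that the product needs. *)
pose nu : {finite_measure set R -> \bar R} := mfrestr measurableT pXoo.
pose rho := measure_function_pushforward__canonical__measure_function_Measure mu mXY.
(* The absolute value makes [G] nonnegative on the whole plane, as Tonelli requires; it disappears
   along [X >= 0]. *)
pose G (z : R * R) := (`|z.1| * g z.2)%:E.
have mG : measurable_fun setT G.
  apply/measurable_EFinP; apply: measurable_funM.
    apply: measurableT_comp => //; exact: measurable_fst.
  apply: measurableT_comp => //; exact: measurable_snd.
have G0 z : (0 <= G z)%E by rewrite lee_fin mulr_ge0.
have mgE : measurable_fun setT (EFin \o g) by apply/measurable_EFinP.
have mXE : measurable_fun setT (EFin \o X) by apply/measurable_EFinP.
have -> : (\int[P]_(w in F) (X w * g (Y w))%:E = \int[rho]_z G z)%E.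
  rewrite ge0_integral_pushforward//= preimage_setT.
  rewrite integral_mfrestr//=; last first.
    by apply: measurableT_comp => //; exact: measurable_fun_pair.
  by apply: eq_integral => w _; rewrite /G/= ger0_norm.
have -> : (\int[rho]_z G z = \int[nu \x Q]_z G z)%E.
  apply: eq_measure_integral => A mA _; apply/esym; apply: product_measure_unique => //.
  move=> B1 B2 mB1 mB2; rewrite /rho /nu /= /mfrestr/= /mrestr /pushforward/= /mrestr setIT.
  rewrite [X in P X](_ : _ = F `&` X @^-1` B1 `&` Y @^-1` B2).
    by rewrite ind// [in RHS]setIC.
  by apply/seteqP; split => w /=; tauto.
rewrite fubini_tonelli1//= /fubini_F.
under eq_integral => x _.
  rewrite /G/=; under eq_integral do rewrite EFinM.
  rewrite ge0_integralZl//; last 1 first.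
    by move=> y _; rewrite lee_fin.
  over.
have I0 : (0 <= \int[Q]_y (g y)%:E)%E by apply: integral_ge0 => y _; rewrite lee_fin.
rewrite ge0_integralZr//; last first.
  by apply/measurable_EFinP.
congr (_ * _)%E.
rewrite integral_mfrestr//; last first.
  by apply/measurable_EFinP.
rewrite ge0_integral_pushforward//=; last first.
  by apply/measurable_EFinP.
rewrite preimage_setT integral_mfrestr//=.
- by apply: eq_integral => w _; rewrite ger0_norm.
- by apply/measurable_EFinP; exact: measurableT_comp.
Qed.

(** * The exponential supermartingale *)

Lemma markov_off_subset (d : measure_display) (T : measurableType d)
  (R : realType) (mu : {measure set T -> \bar R}) (B D : set T) (f : T -> R) (x : R) :
  measurable B -> measurable D -> B `<=` D -> measurable_fun setT f ->
  (forall w, 0 <= f w) -> (forall w, (D `\` B) w -> x <= f w) -> 0 <= x ->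
  (\int[mu]_(w in B) (f w)%:E + x%:E * mu (D `\` B) <= \int[mu]_(w in D) (f w)%:E)%E.
Proof.
move=> mB mD BD mf f0 fx x0; have mDB := measurableD mD mB.
have mfE : measurable_fun setT (EFin \o f) by apply/measurable_EFinP.
rewrite -{2}(setDUK BD) ge0_integral_setU//.
- apply: leeD => //; rewrite -integral_cst//.
  by apply: ge0_le_integral => //; exact: measurable_funTS.
- exact: measurable_funTS.
- by move=> w _; rewrite lee_fin.
- by apply/disj_setPS => w []/= Bw [].
Qed.

(* First-passage argument: on the event of no crossing the integral does not increase, and
   each new crossing event [D] takes away at least [x * P D]. *)
Lemma ville_finite_horizon (d : measure_display) (T : measurableType d)
  (R : realType) (P : probability T R) (M : nat -> T -> R) (x : R) :
  (forall t, measurable_fun setT (M t)) -> (forall t w, 0 <= M t w) -> 0 <= x ->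
  (\int[P]_w (M 0%N w)%:E <= 1)%E ->
  (forall t G, G = [set w | forall s, (s <= t)%N -> M s w < x] ->
     (\int[P]_(w in G) (M t.+1 w)%:E <= \int[P]_(w in G) (M t w)%:E)%E) ->
  forall H, (x%:E * P [set w | exists2 s, (s <= H)%N & (x <= M s w)%R] <= 1)%E.
Proof.
move=> mM M0 x0 init step H.
pose G t := [set w | forall s, (s <= t)%N -> M s w < x].
have mlt s : measurable [set w | M s w < x].
  rewrite [X in measurable X](_ : _ = setT `&` M s @^-1` `]-oo, x[%classic).
    exact: mM.
  by rewrite setTI; apply/seteqP; split => w /=; rewrite in_itv.
have mG t : measurable (G t).
  rewrite [X in measurable X](_ : _ = \bigcap_(s in [set s | (s <= t)%N]) [set w | M s w < x]).
    by apply: bigcap_measurable => //; exists 0%N.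
  by apply/seteqP; split => w /= h s; exact: h.
have -> : [set w | exists2 s, (s <= H)%N & x <= M s w] = ~` G H.
  apply/seteqP; split => [w [s sH xM] /(_ s sH)|w /existsNP [s /not_implyP[sH /negP xM]]].
    by rewrite ltNge xM.
  by exists s => //; rewrite leNgt.
(* The mass still carried by the uncrossed paths must be kept for the induction on the horizon to
   close. *)
suff key : (\int[P]_(w in G H) (M H w)%:E + x%:E * P (~` G H) <= 1)%E.
  apply: le_trans key; rewrite leeDr//; apply: integral_ge0 => w _.
  by rewrite lee_fin.
elim: H => [|H IH].
  apply: le_trans init; rewrite -setTD; apply: markov_off_subset => // w [_ /existsNP[s]].
  by case: s => [/not_implyP[_ /negP]|s /not_implyP[]//]; rewrite -leNgt.
apply: (le_trans _ IH).
have GS : G H.+1 `<=` G H by move=> w Gw s sH; apply: Gw; exact: leqW.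
have -> : ~` G H.+1 = (G H `\` G H.+1) `|` ~` G H.
  apply/seteqP; split => w /=; first by have [] := pselect (G H w); [left|right].
  by case=> [[]//|+ h]; apply; exact: GS.
rewrite measureU//; last 3 first.
- exact: measurableD.
- exact: measurableC.
- by apply/seteqP; split => w // [[]].
rewrite muleDr//; last by apply: ge0_adde_def; rewrite inE.
rewrite addeA; apply: leeD => //; apply: le_trans (step H _ erefl).
apply: markov_off_subset => // w [Gw /existsNP[s /not_implyP[]]].
rewrite leq_eqVlt => /predU1P[->|]; first by move/negP; rewrite -leNgt.
by rewrite ltnS => /Gw.
Qed.

Section Supermartingale.
Context {R : realType} {dT dW : measure_display}
        {T : measurableType dT} {TW : measurableType dW} {K : nat}.
Variables (W : T -> TW) (A : nat -> T -> 'I_K) (Y : nat -> T -> R).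

(** [T] with the sigma-algebra of the first [t] rounds, so that being determined by past data is
    ordinary measurability on this type. *)
Local Notation dataType t := (g_sigma_algebraType (data_gen W A Y t)).

(** The exponential process with tilt [l]; the number [p] stands for [psi l], the bound on the
    log-moment generating function. *)
Definition expmart (k : 'I_K) (m p l : R) (t : nat) (w : T) : R :=
  expR (l * (Ssum A Y k t w - m * Ncount A k t w) - p * Ncount A k t w).

Lemma NcountS k t w : Ncount A k t.+1 w = Ncount A k t w + (A t w == k)%:R :> R.
Proof. by rewrite /Ncount big_ord_recr. Qed.

Lemma SsumS k t w : Ssum A Y k t.+1 w = Ssum A Y k t w + (A t w == k)%:R * Y t w.
Proof. by rewrite /Ssum big_ord_recr. Qed.

Lemma data_sigma_filt t : data_sigma W A Y t `<=` filt W A Y t.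
Proof.
apply: sub_sigma_algebra2 => E [?|[[s [k [st ->]]]|?]]; [by left| |by right; right].
by right; left; exists s, k; rewrite ltnW.
Qed.

Lemma measurable_data_Y s t : (s < t)%N ->
  measurable_fun (setT : set (dataType t)) (Y s : dataType t -> R).
Proof.
move=> st _ B mB; rewrite setTI; apply: sub_sigma_algebra.
by right; right; exists s, B.
Qed.

Lemma measurable_data_A k s t : (s < t)%N ->
  measurable_fun (setT : set (dataType t)) ((fun w => (A s w == k)%:R) : dataType t -> R).
Proof.
move=> st.
have mA : measurable ([set w | A s w = k] : set (dataType t)).
  by apply: sub_sigma_algebra; right; left; exists s, k.
apply: eq_measurable_fun (measurable_indic mA) => w _.
by rewrite indicE; case: eqP => h; [rewrite mem_set|rewrite memNset].
Qed.

Lemma measurable_data_Ncount k s t : (s <= t)%N ->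
  measurable_fun (setT : set (dataType t)) (Ncount A k s : dataType t -> R).
Proof.
move=> st; apply: measurable_sum => i.
by apply: measurable_data_A; exact: leq_trans st.
Qed.

Lemma measurable_data_Ssum k s t : (s <= t)%N ->
  measurable_fun (setT : set (dataType t)) (Ssum A Y k s : dataType t -> R).
Proof.
move=> st; apply: measurable_sum => i; apply: measurable_funM.
- by apply: measurable_data_A; exact: leq_trans st.
- by apply: measurable_data_Y; exact: leq_trans st.
Qed.

Lemma measurable_data_expmart k m p l s t : (s <= t)%N ->
  measurable_fun (setT : set (dataType t)) (expmart k m p l s : dataType t -> R).
Proof.
move=> st; apply: measurableT_comp => //; apply: measurable_funB.
- apply: measurable_funM => //; apply: measurable_funB; first exact: measurable_data_Ssum.
  by apply: measurable_funM => //; exact: measurable_data_Ncount.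
- by apply: measurable_funM => //; exact: measurable_data_Ncount.
Qed.

Hypothesis mW : measurable_fun setT W.
Hypothesis mA : forall t k, measurable [set w | A t w = k].
Hypothesis mY : forall t, measurable_fun setT (Y t).

Lemma filt_measurable t : filt W A Y t `<=` measurable.
Proof.
apply: smallest_sub; first exact: sigma_algebra_measurable.
move=> E [[B [mB ->]]|[[s [k [_ ->]]]//|[s [B [_ [mB ->]]]]]].
- by rewrite -[X in measurable X]setTI; exact: mW.
- by rewrite -[X in measurable X]setTI; exact: mY.
Qed.

Lemma data_sigma_measurable t : data_sigma W A Y t `<=` measurable.
Proof. by move=> E /data_sigma_filt /filt_measurable. Qed.

Lemma measurable_fun_data t (f : T -> R) :
  measurable_fun (setT : set (dataType t)) (f : dataType t -> R) ->
  measurable_fun setT f.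
Proof.
move=> mf _ B mB; rewrite setTI; apply: (@data_sigma_measurable t).
by have := mf measurableT B mB; rewrite setTI.
Qed.

Variables (P : probability T R) (Pk : 'I_K -> probability R R).
Hypothesis indep : forall (t : nat) (E : set T) (k : 'I_K) (B : set R),
  filt W A Y t E -> measurable B ->
  P (E `&` [set w | A t w = k] `&` Y t @^-1` B)
    = (P (E `&` [set w | A t w = k]) * Pk k B)%E.

Variables (k : 'I_K) (m p l : R).
Hypothesis mgf : (\int[Pk k]_y (expR (l * (y - m)))%:E <= (expR p)%:E)%E.

Local Notation M := (expmart k m p l).

Lemma measurable_expmart t : measurable_fun setT (M t).
Proof. by apply: (@measurable_fun_data t); exact: measurable_data_expmart. Qed.

(** If arm [k] is not pulled the process does not move. If it is pulled, the process is multiplied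
    by [expR (l * (Y t - m) - p)], which is independent of the past and has mean at most 1. *)
Lemma expmart_step t (F : set T) : filt W A Y t F ->
  (\int[P]_(w in F) (M t.+1 w)%:E <= \int[P]_(w in F) (M t w)%:E)%E.
Proof.
move=> fF; have mF := filt_measurable _ _ fF.
have mM u : measurable_fun setT (EFin \o M u) by apply/measurable_EFinP/measurable_expmart.
have mAt := mA t k.
have M0 u D w : D w -> (0 <= (M u w)%:E)%E by rewrite lee_fin expR_ge0.
have MS D u : measurable_fun D (EFin \o M u) by exact: measurable_funTS.
have FE : F = (F `&` [set w | A t w = k]) `|` (F `\` [set w | A t w = k]) by rewrite setUIDK.
rewrite FE !ge0_integral_setU//; last 10 first.
- exact: measurableI.
- exact: measurableD.
- exact: MS.
- exact: M0.
- by apply/disj_setPS => w [[_ ?] []].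
- exact: measurableI.
- exact: measurableD.
- exact: MS.
- exact: M0.
- by apply/disj_setPS => w [[_ ?] []].
apply: leeD; last first.
  rewrite le_eqVlt; apply/orP; left; apply/eqP; apply: eq_integral => w.
  rewrite inE => -[_ /eqP/negbTE Atk]; congr EFin.
  by rewrite /expmart NcountS SsumS Atk mul0r !addr0.
pose g y := expR (l * (y - m) - p).
have mg : measurable_fun setT g.
  apply: measurableT_comp => //; apply: measurable_funB => //.
  by apply: measurable_funM => //; exact: measurable_funB.
rewrite (eq_integral (fun w => (M t w * g (Y t w))%:E)); last first.
  move=> w; rewrite inE => -[_ /= Atk]; congr EFin.
  rewrite /expmart NcountS SsumS Atk eqxx mul1r /g -expRD; congr expR.
  rewrite /= mulr1n; ring.
rewrite (@integral_mul_indep _ _ _ _ (Pk k))//.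
- rewrite -[leRHS]mule1; apply: lee_wpmul2l.
    by apply: integral_ge0 => w _; exact: (M0 t setT).
  rewrite /g; under eq_integral do rewrite expRD EFinM.
  rewrite ge0_integralZr//; last first.
    apply/measurable_EFinP; apply: measurableT_comp => //.
    by apply: measurable_funM => //; exact: measurable_funB.
  rewrite expRN -(@mulfV _ (expR p)) ?gt_eqF ?expR_gt0// [leRHS]EFinM.
  by apply: lee_wpmul2r => //; rewrite lee_fin invr_ge0 expR_ge0.
- exact: measurableI.
- exact: measurable_expmart.
- by move=> w; exact: expR_ge0.
- by move=> w; exact: expR_ge0.
(* [M t] depends only on rounds before [t], so this intersection is again an event of [filt t], to
   which [indep] applies. *)
move=> B1 B2 mB1 mB2; have fE : filt W A Y t (F `&` M t @^-1` B1).
  apply: (@measurableI _ (g_sigma_algebraType (filt_gen W A Y t))) => //.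
  apply: data_sigma_filt.
  by have := @measurable_data_expmart k m p l _ _ (leqnn t) measurableT _ mB1; rewrite setTI.
have := indep t _ k B2 fE mB2.
by rewrite [F `&` M t @^-1` B1 `&` _]setIAC.
Qed.

Lemma expmart_ville (x : R) : 0 <= x ->
  (x%:E * P [set w | exists s, (x <= M s w)%R] <= 1)%E.
Proof.
move=> x0.
have init : (\int[P]_w (M 0%N w)%:E <= 1)%E.
  rewrite (eq_integral (cst 1%E)).
    by rewrite integral_cst// mul1e; exact: probability_le1.
  by move=> w _; rewrite /expmart /Ssum /Ncount !big_ord0 !mulr0 subrr mulr0 subr0 expR0.
have fin H : (x%:E * P [set w | exists2 s, (s <= H)%N & (x <= M s w)%R] <= 1)%E.
  apply: ville_finite_horizon => //.
  - exact: measurable_expmart.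
  - by move=> t w; exact: expR_ge0.
  move=> t _ ->; apply: expmart_step; apply: data_sigma_filt.
  rewrite [X in data_sigma _ _ _ _ X](_ : _ = \bigcap_(s in [set s | (s <= t)%N]) (M s @^-1` `]-oo, x[%classic)).
    apply: (@bigcap_measurable _ (dataType t)); first by exists 0%N.
    move=> s st; have := @measurable_data_expmart k m p l _ _ st measurableT `]-oo, x[%classic.
    by rewrite setTI; apply; exact: measurable_itv.
  by apply/seteqP; split => w /= h s /h; rewrite /= in_itv.
have [->|x_neq0] := eqVneq x 0; first by rewrite mul0e.
have xgt0 : 0 < x by rewrite lt_neqAle eq_sym x_neq0.
rewrite -lee_pdivlMl// mule1.
(* The infinite horizon is reached by continuity of [P] along increasing finite horizons. *)
rewrite [X in P X](_ : _ = \bigcup_H [set w | exists2 s, (s <= H)%N & x <= M s w]).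
  apply: measure_bigcup_le.
  - move=> H; rewrite [X in measurable X](_ : _ =
        \bigcup_(s in [set s | (s <= H)%N]) (M s @^-1` `[x, +oo[%classic)).
      apply: bigcup_measurable => s _.
      by rewrite -[X in measurable X]setTI; exact: measurable_expmart.
    by apply/seteqP; split => w /= [s sH]; rewrite /= ?in_itv ?andbT => h; exists s;
      rewrite //= ?in_itv ?andbT.
  - by move=> H H' HH'; apply/subsetPset => w [s sH ?]; exists s => //; exact: leq_trans sH HH'.
  - by move=> H; rewrite -[leRHS]mule1 lee_pdivlMl//; exact: fin.
by apply/seteqP; split => w /= [s]; [exists s => //; exists s|move=> _ [u _]; exists u].
Qed.

End Supermartingale.

(** * The convex conjugate *)

Section ConjugateLoss.
Context {R : realType}.
Variables (psi : R -> R) (lmin lmax : \bar R).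

(** The superlevel set of the conjugate [psi*] at height [c], with the supremum replaced by a
    witness. As a union of open sets it is open, hence Borel. *)
Definition conj_above (c : R) : set R :=
  [set z | exists2 l, in_Lam lmin lmax l & c < l * z - psi l].

Lemma open_conj_above c : open (conj_above c).
Proof.
rewrite (_ : conj_above c = \bigcup_(l in in_Lam lmin lmax) ((fun z => l * z - psi l) @^-1` [set x | c < x])).
  apply: bigcup_open => l _; apply: open_comp; last exact: open_gt.
  by move=> z _; apply: cvgB; [exact: mulrl_continuous|exact: cvg_cst].
by apply/seteqP; split => z [l]; exists l.
Qed.

Lemma psi_mu_star_le mu z (c : R) :
  (forall l, in_Lam lmin lmax l -> l * (z - mu) - psi l <= c) ->
  (psi_mu_star psi lmin lmax mu z <= c%:E)%E.
Proof.
move=> H; apply: ge_ereal_sup => _ /= [l lL <-]; rewrite lee_fin.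
by apply: le_trans (H l lL); rewrite /psi_mu mulrBr opprD addrA.
Qed.

Hypotheses (lmin0 : (lmin < 0%:E)%E) (lmax0 : (0%:E < lmax)%E).
Hypothesis psi_ge0 : forall l, in_Lam lmin lmax l -> 0 <= psi l.
Hypothesis psi_cvx : forall x y s, in_Lam lmin lmax x -> in_Lam lmin lmax y ->
  x != y -> 0 < s -> s < 1 -> psi (s * x + (1 - s) * y) < s * psi x + (1 - s) * psi y.
Hypothesis psi0 : psi 0 = 0.

Let Lam0 : in_Lam lmin lmax 0. Proof. by []. Qed.

Lemma psi_mu_star_ge0 mu z : (0 <= psi_mu_star psi lmin lmax mu z)%E.
Proof.
by apply: ereal_sup_ubound; exists 0 => //; rewrite /psi_mu !mul0r psi0 addr0 subrr.
Qed.

Lemma psi_mu_star_mean mu : psi_mu_star psi lmin lmax mu mu = 0%E.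
Proof.
apply/eqP; rewrite eq_le psi_mu_star_ge0 andbT.
by apply: psi_mu_star_le => l lL; rewrite subrr mulr0 sub0r oppr_le0 psi_ge0.
Qed.

Lemma psi_scale_lt s l : in_Lam lmin lmax l -> l != 0 -> 0 < s -> s < 1 ->
  psi (s * l) < s * psi l.
Proof.
by move=> lL l0 s0 s1; have := psi_cvx _ _ _ lL Lam0 l0 s0 s1; rewrite psi0 !mulr0 !addr0.
Qed.

(** A zero at [l] would, by strict convexity between 0 and [l], make [psi] negative at [l / 2]. *)
Lemma psi_gt0 l : in_Lam lmin lmax l -> l != 0 -> 0 < psi l.
Proof.
move=> lL l0; rewrite lt_neqAle psi_ge0// andbT; apply/eqP => pl.
have h1 : (2^-1 : R) < 1 by lra.
have := psi_scale_lt 2^-1 l lL l0 ltac:(lra) h1; rewrite -pl mulr0 ltNge psi_ge0//.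
case: lL => a b; split.
- have [l_ge0|l_lt0] := leP 0 l; last by apply: (lt_trans a); rewrite lte_fin; lra.
  by apply: (lt_le_trans lmin0); rewrite lee_fin; lra.
- have [l_le0|l_gt0] := leP l 0; last by apply: lt_trans b; rewrite lte_fin; lra.
  by apply: le_lt_trans lmax0; rewrite lee_fin; lra.
Qed.

(** Supplies a symmetric pair of tilts, for the derivative of the conjugate at the mean and for the
    two signs of a deviation. *)
Lemma in_Lam_small (eps : R) : 0 < eps ->
  exists e, [/\ 0 < e, e <= eps, in_Lam lmin lmax e & in_Lam lmin lmax (- e)].
Proof.
move=> e0.
have [a [a0 ale al]] : exists a, [/\ 0 < a, a <= eps & (a%:E < lmax)%E].
  case: lmax lmax0 => [r| |]//; rewrite ?lte_fin => r0; last by exists eps; rewrite ltry.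
  exists (Num.min eps (r / 2)); rewrite lt_min e0 ge_min lexx lte_fin gt_min.
  by split => //; [lra|apply/orP; right; lra].
have [b [b0 ble bl]] : exists b, [/\ 0 < b, b <= eps & (lmin < (- b)%:E)%E].
  case: lmin lmin0 => [r| |]//; rewrite ?lte_fin => r0; last by exists eps; rewrite ltNyr.
  exists (Num.min eps (- r / 2)); rewrite lt_min e0 ge_min lexx lte_fin ltrNr gt_min.
  by split => //; [lra|apply/orP; right; lra].
exists (Num.min a b); rewrite lt_min a0 b0 ge_min ale; split => //; split.
- by apply: (lt_trans lmin0); rewrite lte_fin lt_min a0.
- by apply: le_lt_trans al; rewrite lee_fin ge_min lexx.
- by apply: (lt_le_trans bl); rewrite lee_fin lerN2 ge_min lexx orbT.
- by apply: lt_trans lmax0; rewrite lte_fin oppr_lt0 lt_min a0.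
Qed.

(** This is [psi*(z) = o(z)] at 0. Tilts with [|l| <= e <= eps] contribute at most [eps * |z|]
    because [psi >= 0]. For larger tilts convexity gives [psi l >= (|l| / e) * psi (e or -e)], which
    dominates [l * z] once [|z| <= d]. *)
Lemma conj_small (eps : R) : 0 < eps -> exists2 d, 0 < d &
  forall z l, `|z| <= d -> in_Lam lmin lmax l -> l * z - psi l <= eps * `|z|.
Proof.
move=> /in_Lam_small[e [e0 ele eL neL]].
have pe := psi_gt0 _ eL (lt0r_neq0 e0).
have ne0 : - e != 0 by rewrite oppr_eq0 gt_eqF.
have pne := psi_gt0 _ neL ne0.
exists (Num.min (psi e) (psi (- e)) / e); first by rewrite divr_gt0// lt_min pe.
move=> z l; rewrite ler_pdivlMr// le_min => /andP[z1 z2] lL.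
have [le|le] := leP `|l| e.
  apply: (@le_trans _ _ (`|l| * `|z|)).
    by rewrite -normrM (le_trans _ (ler_norm _))// lerBlDr lerDl psi_ge0.
  by rewrite ler_wpM2r// (le_trans le).
apply: (@le_trans _ _ 0); last by rewrite mulr_ge0// (le_trans _ ele)// ltW.
rewrite subr_le0; have l_gt0 : 0 < `|l| := lt_trans e0 le.
have l0 : l != 0 by rewrite -normr_gt0.
have s0 : 0 < e / `|l| by rewrite divr_gt0.
have s1 : e / `|l| < 1 by rewrite ltr_pdivrMr// mul1r.
have h2 := ltW (psi_scale_lt _ _ lL l0 s0 s1).
apply: (le_trans (ler_norm _)); rewrite normrM.
suff : `|z| * e <= psi (e / `|l| * l).
  move=> h1; have := le_trans h1 h2.
  by rewrite mulrAC ler_pdivlMr// mulrAC [X in _ <= X]mulrC ler_pM2r// mulrC.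
have [l_ge0|l_lt0] := leP 0 l.
  by rewrite (ger0_norm l_ge0) divfK.
by rewrite (ltr0_norm l_lt0) invrN mulrN mulNr divfK.
Qed.

Lemma derive1_psi_mu_star mu :
  derive1 (fun z => fine (psi_mu_star psi lmin lmax mu z)) mu = 0.
Proof.
rewrite /derive1; apply/cvg_lim => //; apply/cvgrPdist_le => eps e0.
have [d d0 H] := conj_small _ e0.
near=> h.
have h0 : h != 0 by near: h; exact: nbhs_dnbhs_neq.
have hd : `|h| <= d.
  by near: h; apply: dnbhs0_le.
have le : (psi_mu_star psi lmin lmax mu (h + mu) <= (eps * `|h|)%:E)%E.
  by apply: psi_mu_star_le => l lL; rewrite addrK; exact: H.
have ge := psi_mu_star_ge0 mu (h + mu).
(* Near the mean the conjugate is finite, so [fine] does not return its default value there. *)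
have fin : psi_mu_star psi lmin lmax mu (h + mu) \is a fin_num.
  by rewrite ge0_fin_numE// (le_lt_trans le)// ltry.
rewrite psi_mu_star_mean /= subr0 sub0r normrN normrZ normfV.
rewrite ler_pdivrMl ?normr_gt0// ger0_norm ?fine_ge0// mulrC.
by rewrite -lee_fin fineK.
Unshelve. all: by end_near. Qed.

Lemma bregman_lossE z mu :
  bregman_loss psi lmin lmax z mu = psi_mu_star psi lmin lmax mu z.
Proof.
by rewrite /bregman_loss derive1_psi_mu_star psi_mu_star_mean mul0r !sube0.
Qed.

End ConjugateLoss.

(** * Deviation of the sample means *)

Lemma measurable_data_muhat (R : realType) (dT dW : measure_display)
  (T : measurableType dT) (TW : measurableType dW) (K : nat)
  (W : T -> TW) (A : nat -> T -> 'I_K) (Y : nat -> T -> R) k s t : (s <= t)%N ->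
  measurable_fun (setT : set (g_sigma_algebraType (data_gen W A Y t)))
    (muhat A Y k s : g_sigma_algebraType (data_gen W A Y t) -> R).
Proof.
move=> st; apply: measurable_funM; first exact: measurable_data_Ssum.
(* Counts are nonnegative, so the inverse agrees with the real power [-1], whose measurability is
   known. *)
rewrite (_ : (fun _ => _) = (fun x : R => x `^ (-1)) \o Ncount A k s); last first.
  apply/funext => w /=; rewrite powR_inv1//.
  by apply: sumr_ge0 => i _; rewrite ler0n.
by apply: measurableT_comp; [exact: measurable_powR|exact: measurable_data_Ncount].
Qed.

Lemma measurable_data_conj_above (R : realType) (dT dW : measure_display)
  (T : measurableType dT) (TW : measurableType dW) (K : nat)
  (W : T -> TW) (A : nat -> T -> 'I_K) (Y : nat -> T -> R)
  (psi : R -> R) (lmin lmax : \bar R) (k : 'I_K) (m x c : R) s t : (s <= t)%N ->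
  data_sigma W A Y t [set w | x <= Ncount A k s w /\
    conj_above psi lmin lmax c (muhat A Y k s w - m)].
Proof.
move=> st; pose dataType := g_sigma_algebraType (data_gen W A Y t).
have mN : measurable_fun (setT : set dataType) (Ncount A k s : dataType -> R).
  exact: measurable_data_Ncount.
have mh : measurable_fun (setT : set dataType)
    ((fun w => muhat A Y k s w - m) : dataType -> R).
  by apply: measurable_funB => //; exact: measurable_data_muhat.
have mO := open_measurable (open_conj_above psi lmin lmax c).
have := mh measurableT _ mO; rewrite setTI.
by apply: (@measurableI _ dataType); exact: measurable_superlevel mN.
Qed.

Section Deviation.
Context {R : realType} {dT dW : measure_display}
        {T : measurableType dT} {TW : measurableType dW} {K : nat}.
Variables (W : T -> TW) (A : nat -> T -> 'I_K) (Y : nat -> T -> R).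
Hypothesis mW : measurable_fun setT W.
Hypothesis mA : forall t k, measurable [set w | A t w = k].
Hypothesis mY : forall t, measurable_fun setT (Y t).
Variables (P : probability T R) (Pk : 'I_K -> probability R R).
Hypothesis indep : forall (t : nat) (E : set T) (k : 'I_K) (B : set R),
  filt W A Y t E -> measurable B ->
  P (E `&` [set w | A t w = k] `&` Y t @^-1` B)
    = (P (E `&` [set w | A t w = k]) * Pk k B)%E.
Variables (psi : R -> R) (lmin lmax : \bar R) (k : 'I_K) (m : R).
Hypotheses (lmin0 : (lmin < 0%:E)%E) (lmax0 : (0%:E < lmax)%E).
Hypothesis psi_ge0 : forall l, in_Lam lmin lmax l -> 0 <= psi l.
Hypothesis mgf : forall l, in_Lam lmin lmax l ->
  (\int[Pk k]_y (expR (l * (y - m)))%:E <= (expR (psi l))%:E)%E.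

Local Notation N := (@Ncount R dT T K A k).
Local Notation S := (Ssum A Y k).

Let mN s : measurable_fun setT (N s : T -> R).
Proof. by apply: (@measurable_fun_data _ _ _ _ _ _ _ _ Y mW mA mY s); exact: measurable_data_Ncount. Qed.

Let mS s : measurable_fun setT (S s).
Proof. by apply: (@measurable_fun_data _ _ _ _ _ _ _ _ Y mW mA mY s); exact: measurable_data_Ssum. Qed.

(* For [sg * l > 0] the sets [{z | c < l z - psi l}] are nested half-lines, so that their union
   is an increasing union of countably many of them, each controlled by a single [l]. *)
Lemma half_line_deviation (sg c x : R) : sg * sg = 1 -> 0 < c -> 0 < x ->
  (exists2 l, in_Lam lmin lmax l & 0 < sg * l) ->
  exists U, [/\ measurable U, (P U <= (expR (- (x * c)))%:E)%E &
    forall w s l, x <= N s w -> in_Lam lmin lmax l -> 0 < sg * l ->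
      c < l * (muhat A Y k s w - m) - psi l -> U w].
Proof.
move=> sg2 c0 x0 [l0 l0L l0sg].
(* Since [sg * sg = 1], the condition [c < l * z - psi l] reads [th l < sg * z]; the union of these
   half-lines is [inf D < sg * z]. *)
pose th l := (c + psi l) / (sg * l).
pose D := [set th l | l in [set l | in_Lam lmin lmax l /\ 0 < sg * l]].
have D0 y : D y -> 0 < y.
  by move=> [l [lL lsg] <-]; rewrite divr_gt0// ltr_pwDl// psi_ge0.
have infD : has_inf D.
  by split; [exists (th l0), l0|exists 0 => y /D0/ltW].
pose r i := inf D + i.+1%:R^-1.
(* The condition [r i <= sg * (muhat - m)] multiplied through by the count; [r i] decreases to
   [inf D], so these sets grow with [i]. *)
pose Us i s := [set w | x <= N s w /\ r i * N s w <= sg * (S s w - m * N s w)].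
pose U i := \bigcup_s Us i s.
have mUs i s : measurable (Us i s).
  rewrite (_ : Us i s = [set w | x <= N s w] `&`
      [set w | 0 <= sg * (S s w - m * N s w) - r i * N s w]); last first.
    by apply/seteqP; split => w; rewrite /Us /= subr_ge0.
  apply: measurableI; apply: measurable_superlevel; first exact: (mN s).
  apply: measurable_funB.
    apply: measurable_funM => //; apply: measurable_funB => //.
    by apply: measurable_funM => //; exact: (mN s).
  by apply: measurable_funM => //; exact: (mN s).
have mU i : measurable (U i) by exact: bigcup_measurable.
have N0 s w : x <= N s w -> 0 < N s w by exact: (lt_le_trans x0).
exists (\bigcup_i U i); split; first exact: bigcup_measurable.
- apply: measure_bigcup_le => //.
    move=> i j ij; apply/subsetPset => w [s _ [xN le]]; exists s => //; split => //.
    apply: le_trans le; rewrite ler_wpM2r ?(ltW (N0 _ _ xN))// lerD2l.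
    by rewrite lef_pV2 ?posrE// ler_nat.
  (* Some tilt [l] has its threshold below [r i]. On [U i] the exponent of its supermartingale is at
     some time at least [c * N], hence at least [x * c], and Ville's inequality applies at height
     [expR (x * c)]. *)
  move=> i; have i0 : 0 < (i.+1%:R^-1 : R) by rewrite invr_gt0.
  have [_ [l [lL lsg] <-] thl] := inf_adherent i0 infD.
  have V := expmart_ville W A Y mW mA mY P Pk indep k m (psi l) l (mgf _ lL) _ (expR_ge0 (x * c)).
  have mV : measurable [set w | exists s, (expR (x * c) <= expmart A Y k m (psi l) l s w)%R].
    rewrite (_ : [set w | _] =
        \bigcup_s [set w | expR (x * c) <= expmart A Y k m (psi l) l s w]).
      apply: bigcup_measurable => s _; apply: measurable_superlevel.
      exact: (measurable_expmart W A Y mW mA mY).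
    by apply/seteqP; split => w /= [s]; [exists s|move=> _ ?; exists s].
  rewrite expRN -[leRHS]mule1 lee_pdivlMl ?expR_gt0//.
  apply: le_trans V; apply: lee_wpmul2l; first by rewrite lee_fin expR_ge0.
  apply: le_measure; rewrite ?inE// => w [s _ [xN le]]; exists s.
  have Nw := N0 _ _ xN.
  rewrite /expmart ler_expR -subr_ge0.
  have lE : l = (sg * l) * sg by rewrite mulrAC sg2 mul1r.
  have h1 : th l * N s w <= sg * (S s w - m * N s w).
    by apply: le_trans le; rewrite ler_pM2r// ltW.
  have h2 : (c + psi l) * N s w <= l * (S s w - m * N s w).
    have := ler_wpM2l (ltW lsg) h1.
    by rewrite mulrA [sg * l * th l]mulrC divfK ?gt_eqF// mulrA -lE.
  have h3 : x * c <= c * N s w by rewrite mulrC ler_pM2l.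
  by lra.
move=> w s l xN lL lsg lt; have Nw := N0 _ _ xN.
have thD : inf D <= th l by apply: ge_inf; [case: infD|exists l].
have gap : th l < sg * (muhat A Y k s w - m).
  rewrite ltr_pdivrMr// mulrC mulrA [sg * l * sg]mulrAC sg2 mul1r; lra.
(* The deviation exceeds [inf D] strictly, which leaves room for some [1 / (i + 1)]. *)
have [i Hi] : exists i : nat, r i < sg * (muhat A Y k s w - m).
  have d0 : 0 < sg * (muhat A Y k s w - m) - inf D by rewrite subr_gt0 (le_lt_trans thD).
  exists (Num.truncn (sg * (muhat A Y k s w - m) - inf D)^-1).
  rewrite /r -ltrBrDl invf_plt ?posrE//.
  exact: truncnS_gt.
exists i => //; exists s => //; split => //.
have -> : S s w - m * N s w = (muhat A Y k s w - m) * N s w.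
  by rewrite /muhat mulrBl divfK ?gt_eqF.
by rewrite mulrA ler_pM2r// ltW.
Qed.

(** The factor 2 counts the two signs of the tilt; [l = 0] cannot be a witness because [c > 0] and
    [psi 0 >= 0]. *)
Lemma conj_above_deviation (c x : R) : 0 < c -> 0 < x ->
  (P [set w | exists s, (x <= N s w)%R /\ conj_above psi lmin lmax c (muhat A Y k s w - m)%R]
     <= (2 * expR (- (x * c)))%:E)%E.
Proof.
move=> c0 x0.
have [e [e0 _ eL neL]] := in_Lam_small lmin lmax lmin0 lmax0 _ ltr01.
have e1 : exists2 l, in_Lam lmin lmax l & 0 < 1 * l by exists e => //; rewrite mul1r.
have e2 : exists2 l, in_Lam lmin lmax l & 0 < -1 * l by exists (- e) => //; rewrite mulrNN mul1r.
have [U [mU PU HU]] := half_line_deviation _ _ _ (mulr1 1) c0 x0 e1.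
have [V [mV PV HV]] := half_line_deviation _ _ _ (etrans (mulrNN _ _) (mulr1 1)) c0 x0 e2.
apply: (@le_trans _ _ (P (U `|` V))).
  apply: le_measure; rewrite ?inE//; last 2 first.
  - exact: measurableU.
  - move=> w [s [xN [l lL lt]]].
    have [l0|l0|l0] := ltgtP l 0.
    + by right; apply: (HV w s l) => //; rewrite mulN1r oppr_gt0.
    + by left; apply: (HU w s l) => //; rewrite mul1r.
    + by move: lt; have := psi_ge0 _ lL; rewrite l0 mul0r; lra.
  rewrite (_ : [set w | _] = \bigcup_s [set w | x <= N s w /\
      conj_above psi lmin lmax c (muhat A Y k s w - m)]); last first.
    by apply/seteqP; split => w /= [s] => [|_]; exists s.
  apply: bigcup_measurable => s _; apply: (data_sigma_measurable W A Y mW mA mY s).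
  exact: measurable_data_conj_above.
apply: (le_trans (measureU2 _ mU mV)).
by rewrite mulr_natl mulr2n EFinD leeD.
Qed.

(* Chosen so that [expR j * level q j = 4 q (1 + ln j)], and so that a loss above [C_b q] in
   epoch [j] is above [level q j]. *)
Definition level (q j : nat) : R := 4 * q%:R * (1 + ln j%:R) / expR j%:R.

(** The horizon [t] makes this an event of the first [t] rounds, and ranging over all [s <= t]
    covers every rewound time. An epoch enters only through its lower end [expR j]. *)
Definition deviation (q t : nat) : set T :=
  [set w | exists s j, [/\ (s <= t)%N, (0 < j)%N, expR j%:R <= N s w &
     conj_above psi lmin lmax (level q j) (muhat A Y k s w - m)]].

Lemma data_sigma_deviation q t : data_sigma W A Y t (deviation q t).
Proof.
rewrite (_ : deviation q t = \bigcup_(s in [set s | (s <= t)%N]) \bigcup_(j in [set j | (0 < j)%N])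
    [set w | expR j%:R <= N s w /\
      conj_above psi lmin lmax (level q j) (muhat A Y k s w - m)]).
  apply: (@bigcup_measurable _ (g_sigma_algebraType (data_gen W A Y t))) => s st.
  apply: (@bigcup_measurable _ (g_sigma_algebraType (data_gen W A Y t))) => j j0.
  exact: measurable_data_conj_above.
apply/seteqP; split => w; first by move=> [s [j [? ? ? ?]]]; exists s => //; exists j.
by move=> [s st [j j0 [? ?]]]; exists s, j.
Qed.

Lemma level_gt0 q j : (0 < q)%N -> (0 < j)%N -> 0 < level q j.
Proof.
move=> q0 j0; rewrite divr_gt0 ?expR_gt0// mulr_gt0// ?mulr_gt0 ?ltr0n//.
by rewrite ltr_pwDl// ln_ge0// ler1n.
Qed.

(* [j^(-4q) <= j^(-2) <= 2 (1/j - 1/(j+1))] makes the union over epochs telescope. *)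
Lemma epoch_tail q j : (0 < q)%N ->
  2 * expR (- (expR j.+1%:R * level q j.+1)) <=
    4 * expR (- (4 * q%:R)) * (j.+1%:R^-1 - j.+2%:R^-1) :> R.
Proof.
move=> q0; rewrite /level [expR _ * (_ / _)]mulrC divfK ?gt_eqF ?expR_gt0//.
rewrite mulrDr mulr1 opprD expRD.
have J0 : 0 < j.+1%:R :> R by rewrite ltr0n.
have L0 : 0 <= ln (j.+1%:R : R) by rewrite ln_ge0// ler1n.
have Q1 : 1 <= q%:R :> R by rewrite ler1n.
have : expR (- (4 * q%:R * ln j.+1%:R)) <= (j.+1%:R ^+ 2)^-1 :> R.
  rewrite -[in leRHS](lnK J0) -expRM_natl -expRN ler_expR lerN2.
  by rewrite ler_wpM2r//; lra.
have : (j.+1%:R ^+ 2)^-1 <= 2 * (j.+1%:R^-1 - j.+2%:R^-1) :> R.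
  rewrite -(natr1 j.+1) -subr_ge0.
  move: J0; have : 1 <= j.+1%:R :> R by rewrite ler1n.
  move: (j.+1%:R) => a a1 a0; have a2 : 0 < a + 1 by rewrite addr_gt0.
  have -> : 2 * (a^-1 - (a + 1)^-1) - (a ^+ 2)^-1 = (a - 1) / (a ^+ 2 * (a + 1)).
    by field; rewrite !gt_eqF.
  by rewrite divr_ge0 ?subr_ge0// mulr_ge0 ?exprn_ge0// ltW.
move=> h1 h2; have h3 := le_trans h2 h1.
have := ler_wpM2l (expR_ge0 (- (4 * q%:R) : R)) h3.
move: (expR _) (expR _) (_ - _) => a b c; lra.
Qed.

(** Union bound over epochs: the horizon is dropped, and the bounds of [epoch_tail] telescope to a
    sum below 1, uniformly in [t]. *)
Lemma deviation_prob q t : (0 < q)%N ->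
  (P (deviation q t) <= (4 * expR (- (4 * q%:R)))%:E)%E.
Proof.
move=> q0.
pose D j := [set w | exists s, expR j.+1%:R <= N s w /\
   conj_above psi lmin lmax (level q j.+1) (muhat A Y k s w - m)].
have mD j : measurable (D j).
  rewrite (_ : D j = \bigcup_s [set w | expR j.+1%:R <= N s w /\
      conj_above psi lmin lmax (level q j.+1) (muhat A Y k s w - m)]); last first.
    by apply/seteqP; split => w /= [s] => [|_]; exists s.
  apply: bigcup_measurable => s _; apply: (data_sigma_measurable W A Y mW mA mY s).
  exact: measurable_data_conj_above.
pose F n := \big[setU/set0]_(i < n) D i.
have mF n : measurable (F n) by exact: bigsetU_measurable.
apply: (@le_trans _ _ (P (\bigcup_n F n))).
  apply: le_measure; rewrite ?inE.
  - by apply: (data_sigma_measurable W A Y mW mA mY t); exact: data_sigma_deviation.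
  - exact: bigcup_measurable.
  - move=> w [s [[|j] []// _ _ ? ?]]; exists j.+1 => //.
    by rewrite /F big_ord_recr /=; right; exists s.
apply: measure_bigcup_le => //.
  by move=> i j ij; exact/subsetPset/subset_bigsetU.
move=> n; apply: (le_trans (Boole_inequality P _)) => //.
apply: (@le_trans _ _ (\sum_(i < n) (4 * expR (- (4 * q%:R)) * (i.+1%:R^-1 - i.+2%:R^-1))%:E)%E).
  apply: lee_sum => i _.
  have x0 := expR_gt0 (i.+1%:R : R).
  apply: (le_trans (conj_above_deviation _ _ (level_gt0 q i.+1 q0 _) x0)) => //.
  by rewrite lee_fin epoch_tail.
rewrite sumEFin lee_fin -mulr_sumr ger_pMr ?mulr_gt0 ?expR_gt0//.
rewrite -(big_mkord xpredT (fun i => i.+1%:R^-1 - i.+2%:R^-1 : R)).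
have -> : \sum_(0 <= i < n) (i.+1%:R^-1 - i.+2%:R^-1 : R) = 1 - n.+1%:R^-1.
  elim: n => [|n IH]; first by rewrite big_nil invr1 subrr.
  by rewrite big_nat_recr//= IH; ring.
by rewrite gerBl invr_ge0.
Qed.

End Deviation.

(** * Mutual information *)

Lemma prob_partition (d : measure_display) (T : measurableType d) (R : realType)
  (P : probability T R) (J : finType) (E : J -> set T) (X : set T) :
  (forall j, measurable (E j)) -> (forall i j, i != j -> E i `&` E j = set0) ->
  (forall w, exists j, E j w) -> measurable X ->
  fine (P X) = \sum_j fine (P (X `&` E j)).
Proof.
move=> mE tE cE mX.
have mXE j : measurable (X `&` E j) by exact: measurableI.
rewrite sum_fine; last by move=> j _; exact: fin_num_measure.
congr fine; rewrite fsbig_seq ?index_enum_uniq// -measure_fin_bigcup//.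
- congr (P _); apply/seteqP; split => [w Xw|w [j _ []]//].
  by have [j Ejw] := cE w; exists j => //=; rewrite mem_index_enum.
- apply/trivIsetP => i j _ _ /tE ij.
  by rewrite setIACA ij setI0.
Qed.

(** Enumeration carries a partition indexed by any finite type, later by Boolean patterns, to the
    ordinals used in [mutual_info]. *)
Lemma mutual_info_ge (d : measure_display) (T : measurableType d) (R : realType)
  (K : nat) (P : probability T R) (kappa : T -> 'I_K) (G : set T -> Prop)
  (J : finType) (E : J -> set T) :
  (forall j, G (E j)) -> (forall i j, i != j -> E i `&` E j = set0) ->
  (forall w, exists j, E j w) ->
  ((\sum_k \sum_j mi_term (fine (P ([set w | kappa w = k] `&` E j)))
      (fine (P [set w | kappa w = k])) (fine (P (E j))))%:E
    <= mutual_info P kappa G)%E.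
Proof.
move=> GE tE cE; apply: ereal_sup_ubound.
exists #|J|, (fun i => E (enum_val i)); split; first by move=> i; exact: GE.
split; first by move=> i j ij; apply: tE; rewrite (inj_eq enum_val_inj).
split; first by move=> w; have [j ?] := cE w; exists (enum_rank j); rewrite enum_rankK.
congr EFin; apply: eq_bigr => k _.
by rewrite (reindex _ (onW_bij _ (@enum_val_bij J))).
Qed.

(* Gibbs variational inequality: [ln x <= x - 1] at [x = pI pJ e^(h-L) / p]. *)
Lemma mi_term_ge (R : realType) (p pI pJ h L : R) : 0 <= p -> p <= pI -> p <= pJ ->
  p * h <= mi_term p pI pJ + L * p + (pI * pJ * expR h * expR (- L) - p).
Proof.
move=> p0 pI0 pJ0; rewrite /mi_term; case: eqP => [->|/eqP p_neq0].
  rewrite mul0r mulr0 !add0r subr0; apply: mulr_ge0; last exact: expR_ge0.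
  apply: mulr_ge0; last exact: expR_ge0.
  by apply: mulr_ge0; exact: le_trans p0 _.
have pgt0 : 0 < p by rewrite lt_neqAle eq_sym p_neq0.
have q0 : 0 < pI * pJ by apply: mulr_gt0; exact: lt_le_trans pgt0 _.
set q := pI * pJ in q0 *.
have x0 : 0 < q / p * expR (h - L) by rewrite mulr_gt0 ?expR_gt0// divr_gt0.
have := @le_ln1Dx _ (q / p * expR (h - L) - 1); rewrite ltrBrDl subrr => /(_ x0).
rewrite [X in ln X]addrC subrK lnM ?posrE ?divr_gt0 ?expR_gt0// expRK.
rewrite !ln_div ?posrE// => /(ler_wpM2l p0).
have -> : p * (q / p * expR (h - L) - 1) = q * expR h * expR (- L) - p.
  by rewrite expRD; field.
lra.
Qed.

(** Summing [mi_term_ge], the correction terms total at most 0: under the product of the marginals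
    [expR (h - L)] has mean at most 1, while [p] has mass 1. *)
Lemma gibbs_variational (R : realType) (I J : finType) (p : I -> J -> R)
  (pI : I -> R) (pJ : J -> R) (h : I -> J -> R) (L : R) :
  (forall i j, 0 <= p i j) -> (forall i, pI i = \sum_j p i j) ->
  (forall j, pJ j = \sum_i p i j) -> \sum_i pI i = 1 ->
  (forall i, \sum_j pJ j * expR (h i j) <= expR L) ->
  \sum_i \sum_j p i j * h i j <= \sum_i \sum_j mi_term (p i j) (pI i) (pJ j) + L.
Proof.
move=> p0 EI EJ p1 HL.
have pleI i j : p i j <= pI i.
  by rewrite EI (bigD1 j)//= lerDl sumr_ge0.
have pleJ i j : p i j <= pJ j.
  by rewrite EJ (bigD1 i)//= lerDl sumr_ge0.
have pI0 i : 0 <= pI i by rewrite EI sumr_ge0.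
apply: (@le_trans _ _ (\sum_i \sum_j (mi_term (p i j) (pI i) (pJ j) + L * p i j
    + (pI i * pJ j * expR (h i j) * expR (- L) - p i j)))).
  by apply: ler_sum => i _; apply: ler_sum => j _; exact: mi_term_ge.
under eq_bigr => i _ do rewrite !big_split/= sumrN -mulr_sumr -EI -mulr_suml.
rewrite !big_split/= sumrN p1 -mulr_sumr p1 mulr1 gerDl subr_le0 -mulr_suml.
rewrite expRN ler_pdivrMr ?expR_gt0// mul1r.
apply: (@le_trans _ _ (\sum_i pI i * expR L)).
  apply: ler_sum => i _; under eq_bigr do rewrite -mulrA.
  by rewrite -mulr_sumr ler_wpM2l.
by rewrite -mulr_suml p1 mul1r.
Qed.

(** The increments [expR (i + 1) - expR i] increase, so the true indices collect at least what an
    initial segment of the same size would, where equality holds. The exponential of a count becomes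
    linear in the indicators, and its mean needs only individual probabilities. *)
Lemma expR_count_le (R : realType) (v : nat -> bool) (n : nat) :
  expR (\sum_(i < n) (v i)%:R) <=
    1 + \sum_(i < n) (expR i.+1%:R - expR i%:R) * (v i)%:R :> R.
Proof.
elim: n => [|n IH]; first by rewrite !big_ord0 expR0 addr0.
rewrite !big_ord_recr/= addrA; case: (v n); last by rewrite mulr0 !addr0.
rewrite mulr1 -(natr1 n) !expRD.
have h : expR (\sum_(i < n) (v i)%:R) <= expR n%:R :> R.
  rewrite ler_expR -[leRHS]mulr1 mulr_natl -[in leRHS](card_ord n) -sumr_const.
  by apply: ler_sum => i _; case: (v i); rewrite ?ler01.
have e1 : 0 <= expR 1 - 1 :> R by rewrite subr_ge0 -[leLHS]expR0 ler_expR.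
have := ler_wpM2r e1 h.
move: IH; rewrite /=; lra.
Qed.

Section EventCount.
Context {d : measure_display} {T : measurableType d} {R : realType} {K : nat}.
Variables (P : probability T R) (kappa : T -> 'I_K) (G : set T -> Prop).
Variables (B : 'I_K -> nat -> set T) (n : nat).

(** The atoms of the finite algebra generated by the events [B k i] of all arms together; [v]
    records which of them occur. *)
Definition event_atom (v : {ffun 'I_K * 'I_n -> bool}) : set T :=
  [set w | forall x, v x = `[< B x.1 x.2 w >]].

Hypothesis mkappa : forall k, measurable [set w | kappa w = k].
Hypothesis mB : forall k i, measurable (B k i).

Local Notation atom := event_atom.

Lemma event_atom_disj u v : u != v -> atom u `&` atom v = set0.
Proof.
move=> /eqP uv; apply/seteqP; split => // w [hu hv]; apply: uv.
by apply/ffunP => x; rewrite hu hv.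
Qed.

Lemma event_atom_cover w : exists v, atom v w.
Proof. by exists [ffun x : 'I_K * 'I_n => `[< B x.1 x.2 w >]] => x; rewrite ffunE. Qed.

Lemma measurable_event_atom v : measurable (atom v).
Proof.
rewrite (_ : atom v = \bigcap_(x in [set: 'I_K * 'I_n])
    (if v x then B x.1 x.2 else ~` B x.1 x.2)).
  apply: fin_bigcap_measurable => [|x _]; first exact: finite_finset.
  by case: (v x) => //; exact: measurableC.
apply/seteqP; split => w /= h x; [move=> _|]; have := h x.
  by case: (v x) => /esym/asboolP.
by case: (v x) => /(_ Logic.I) ?; apply/esym/asboolP.
Qed.

Lemma prob_event_atom_sum (X Z : set T) (b : {ffun 'I_K * 'I_n -> bool} -> bool) :
  measurable X -> (forall v, X `&` atom v = if b v then Z `&` atom v else set0) ->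
  fine (P X) = \sum_v fine (P (Z `&` atom v)) * (b v)%:R.
Proof.
move=> mX XE; rewrite (prob_partition _ _ _ P _ _ _ measurable_event_atom event_atom_disj event_atom_cover mX).
by apply: eq_bigr => v _; rewrite XE; case: (b v); rewrite ?mulr1// mulr0 measure0.
Qed.

(** The Gibbs inequality for the pair of [kappa] and the atom, with [h k v] equal to 1 plus the
    number of events of arm [k] in the pattern [v]. The 1 in [h] is the factor [expR 1] of the
    moment hypothesis. *)
Lemma event_count_mutual_info (L : R) : (forall v, G (atom v)) ->
  (forall k, expR 1 * (1 + \sum_(i < n) (expR i.+1%:R - expR i%:R) * fine (P (B k i)))
     <= expR L) ->
  ((1 + \sum_(i < n) fine (P [set w | B (kappa w) i w]))%:E
     <= mutual_info P kappa G + L%:E)%E.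
Proof.
move=> GE HL.
have mat := measurable_event_atom.
pose Kp k := [set w | kappa w = k].
have tK i j : i != j -> Kp i `&` Kp j = set0.
  by move=> /eqP ij; apply/seteqP; split => // w []; rewrite /Kp/= => ->; exact: ij.
have cK w : exists k, Kp k w by exists (kappa w).
pose p k v := fine (P (Kp k `&` atom v)).
pose h (k : 'I_K) (v : {ffun 'I_K * 'I_n -> bool}) : R := 1 + \sum_(i < n) (v (k, i))%:R.
have gibbs : \sum_k \sum_v p k v * h k v <=
    \sum_k \sum_v mi_term (p k v) (fine (P (Kp k))) (fine (P (atom v))) + L.
  apply: gibbs_variational.
  - by move=> k v; exact/fine_ge0/measure_ge0.
  - by move=> k; apply: prob_partition => //; [exact: event_atom_disj|exact: event_atom_cover|exact: mkappa].
  - move=> v; rewrite (prob_partition _ _ _ P _ _ _ mkappa tK cK (mat v)).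
    by apply: eq_bigr => k _; rewrite setIC.
  - transitivity (fine (P setT)); last by rewrite probability_setT.
    rewrite (prob_partition _ _ _ P _ _ _ mkappa tK cK measurableT).
    by apply: eq_bigr => k _; rewrite setTI.
  move=> k; apply: le_trans (HL k).
  have EB i : fine (P (B k (i : 'I_n))) = \sum_v fine (P (atom v)) * (v (k, i))%:R.
    rewrite (@prob_event_atom_sum _ setT (fun v => v (k, i)))//.
      by under eq_bigr do rewrite setTI.
    move=> v; apply/seteqP; split => w.
      by move=> [Bw aw]; rewrite aw asboolT//; split.
    case: ifPn => // vt [_ aw]; split => //.
    by move: vt; rewrite aw => /asboolP.
  rewrite mulrDr mulr1.
  have E1 : \sum_v fine (P (atom v)) = 1.
    transitivity (fine (P setT)); last by rewrite probability_setT.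
    rewrite (prob_partition _ _ _ P _ _ _ mat event_atom_disj event_atom_cover measurableT).
    by apply: eq_bigr => v _; rewrite setTI.
  apply: (@le_trans _ _ (\sum_v fine (P (atom v)) *
     (expR 1 * (1 + \sum_(i < n) (expR i.+1%:R - expR i%:R) * (v (k, i))%:R)))).
    apply: ler_sum => v _; apply: ler_wpM2l; first exact/fine_ge0/measure_ge0.
    rewrite /h expRD; apply: ler_wpM2l; first exact: expR_ge0.
    (* The pattern is extended by [false] beyond [n], where it is never read. *)
    have := @expR_count_le R (fun i => if insub i is Some j then v (k, j) else false) n.
    rewrite (eq_bigr (fun i : 'I_n => (v (k, i))%:R)); last by move=> i _; rewrite valK.
    move/le_trans; apply; rewrite lerD2l.
    by apply: ler_sum => i _; rewrite valK.
  under eq_bigr do rewrite mulrDr mulr1 mulrDr mulr_sumr mulr_sumr.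
  rewrite big_split/= -mulr_suml E1 mul1r lerD2l exchange_big/= mulr_sumr.
  apply: ler_sum => i _; rewrite EB !mulr_sumr.
  by apply: ler_sum => v _; rewrite le_eqVlt; apply/orP; left; apply/eqP; ring.
have -> : 1 + \sum_(i < n) fine (P [set w | B (kappa w) i w]) = \sum_k \sum_v p k v * h k v.
  under [RHS]eq_bigr => k _.
    rewrite (eq_bigr (fun v => p k v + \sum_(i < n) p k v * (v (k, i))%:R)); last first.
      by move=> v _; rewrite mulrDr mulr1 mulr_sumr.
    rewrite big_split/= exchange_big/= -(prob_partition _ _ _ P _ _ _ mat event_atom_disj event_atom_cover (mkappa k)).
    over.
  rewrite big_split/=; congr (_ + _).
    transitivity (fine (P setT)); first by rewrite probability_setT.
    rewrite (prob_partition _ _ _ P _ _ _ mkappa tK cK measurableT).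
    by apply: eq_bigr => k _; rewrite setTI.
  rewrite exchange_big/=; apply: eq_bigr => i _.
  have CE k : [set w | B (kappa w) i w] `&` Kp k = B k i `&` Kp k.
    by apply/seteqP; split => w /= [Bw kw]; split => //; move: Bw; rewrite kw.
  have mC : measurable [set w | B (kappa w) i w].
    rewrite (_ : [set w | _] = \bigcup_(k in [set: 'I_K]) (B k i `&` Kp k)).
      apply: fin_bigcup_measurable => [|k _]; first exact: finite_finset.
      by apply: measurableI; [exact: mB|exact: mkappa].
    apply/seteqP; split => w /=; first by move=> ?; exists (kappa w).
    by move=> [k _ []]; rewrite /Kp/= => Bw ->.
  rewrite (prob_partition _ _ _ P _ _ _ mkappa tK cK mC); apply: eq_bigr => k _.
  rewrite CE; apply: prob_event_atom_sum; first by apply: measurableI; [exact: mB|exact: mkappa].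
  move=> v; apply/seteqP; split => w.
    by move=> [[Bw kw] aw]; rewrite aw asboolT//; split.
  case: ifPn => // vt [kw aw]; split => //; split => //.
  by move: vt; rewrite aw => /asboolP.
apply: (@le_trans _ _ ((\sum_k \sum_v mi_term (p k v) (fine (P (Kp k))) (fine (P (atom v))) + L)%:E)).
  by rewrite lee_fin.
rewrite EFinD leeD2r//; apply: mutual_info_ge => //.
  exact: event_atom_disj.
exact: event_atom_cover.
Qed.

End EventCount.

(** * Numerical bounds and conclusion *)

(** From [expR (- 1/6) >= 5/6], [e] is at most [(6/5)^6 < 3]. Hence [b >= 3] forces
    [ln (ln b) > 0]. *)
Lemma expR1_lt3 (R : realType) : expR 1 < 3 :> R.
Proof.
have h : 5 / 6 <= expR (- 6^-1) :> R by apply: le_trans (expR_ge1Dx _); lra.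
have E : expR 1 * (expR (- 6^-1) ^+ 3 * expR (- 6^-1) ^+ 3) = 1 :> R.
  by rewrite -expRM_natl -!expRD -[RHS]expR0; congr expR; field.
have h3 : (5 / 6) ^+ 3 <= expR (- 6^-1) ^+ 3 :> R by rewrite lerXn2r ?nnegrE//; lra.
have h6 : (5 / 6) ^+ 3 * (5 / 6) ^+ 3 <= expR (- 6^-1) ^+ 3 * expR (- 6^-1) ^+ 3 :> R.
  by apply: ler_pM => //; apply: exprn_ge0; lra.
have := ler_wpM2l (expR_ge0 (1 : R)) h6; rewrite E.
lra.
Qed.

Lemma expR1_ge (R : realType) : 9 / 4 <= expR 1 :> R.
Proof.
have h : 3 / 2 <= expR 2^-1 :> R by apply: le_trans (expR_ge1Dx _); lra.
have -> : expR 1 = expR 2^-1 * expR 2^-1 :> R by rewrite -expRD; congr expR; field.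
have -> : 9 / 4 = (3 / 2) * (3 / 2) :> R by field.
by apply: ler_pM => //; lra.
Qed.

(** The terms are dominated by a geometric series of ratio [e^-3] and sum [4 / (e (e^2 + e + 1))].
    This is at most 1/4 as [e >= 9/4], and [1 + 1/4 <= expR (1/4)] produces the constant 5/4. *)
Lemma moment_bound (R : realType) (b : nat -> R) (n : nat) :
  (forall i, b i <= 4 * expR (- (4 * i.+1%:R))) ->
  expR 1 * (1 + \sum_(i < n) (expR i.+1%:R - expR i%:R) * b i) <= expR (5 / 4) :> R.
Proof.
move=> hb; have e94 := expR1_ge R; set e := expR 1 in e94 *.
have e0 : 0 < e by exact: expR_gt0.
have eX i : expR i%:R = e ^+ i :> R by rewrite -[i%:R]mulr1 expRM_natl.
pose r := (e ^+ 3)^-1.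
have r0 : 0 < r by rewrite invr_gt0 exprn_gt0.
have key : \sum_(i < n) (expR i.+1%:R - expR i%:R) * b i <= 4^-1 * (1 - r ^+ n).
  elim: n => [|n IH]; first by rewrite big_ord0 expr0 subrr mulr0.
  rewrite big_ord_recr/=.
  have h : (expR n.+1%:R - expR n%:R) * b n <= 4 * (e - 1) / e ^+ 4 * r ^+ n.
    apply: (@le_trans _ _ ((expR n.+1%:R - expR n%:R) * (4 * expR (- (4 * n.+1%:R))))).
      by rewrite ler_wpM2l// subr_ge0 ler_expR ler_nat.
    rewrite !eX expRN -natrM eX /r exprVn -exprM exprS.
    have -> : (4 * n.+1 = 4 + (n + 3 * n))%N by rewrite mulnS (mulSn 3).
    rewrite !exprD; set a := e ^+ n; set c := e ^+ (3 * n).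
    have a0 : a != 0 by rewrite gt_eqF// exprn_gt0.
    have c0 : c != 0 by rewrite gt_eqF// exprn_gt0.
    by rewrite le_eqVlt; apply/orP; left; apply/eqP; field; rewrite ?a0 ?c0 ?gt_eqF.
  have h' : 4 * (e - 1) / e ^+ 4 <= 4^-1 * (1 - r).
    rewrite ler_pdivrMr ?exprn_gt0//.
    have -> : 4^-1 * (1 - r) * e ^+ 4 = 4^-1 * (e ^+ 4 - e).
      by rewrite /r; field; rewrite gt_eqF.
    have -> : e ^+ 4 - e = (e - 1) * (e * (e ^+ 2 + e + 1)) by ring.
    suff : 16 <= e * (e ^+ 2 + e + 1).
      move=> h2; have e1 : 0 <= e - 1 by lra.
      by have := ler_wpM2l e1 h2; lra.
    have h2 : (9 / 4) * (9 / 4) <= e ^+ 2 by rewrite expr2; apply: ler_pM => //; lra.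
    have h3 : (9 / 4) * ((9 / 4) * (9 / 4) + 9 / 4 + 1) <= e * (e ^+ 2 + e + 1).
      by apply: ler_pM; lra.
    lra.
  have h3 := ler_wpM2r (exprn_ge0 n (ltW r0)) h'.
  have -> : 4^-1 * (1 - r ^+ n.+1) = 4^-1 * (1 - r ^+ n) + 4^-1 * (1 - r) * r ^+ n.
    by rewrite exprS; ring.
  by apply: lerD => //; exact: le_trans h h3.
have rn : 0 <= r ^+ n by rewrite exprn_ge0// ltW.
have -> : 5 / 4 = 1 + 4^-1 :> R by field.
rewrite expRD -/e; apply: ler_wpM2l; first exact: ltW.
by apply: le_trans (expR_ge1Dx _); lra.
Qed.

(** [j] is the epoch of [N]. The width of an epoch costs the factor [e], since [N <= e * expR j];
    and [ln j <= ln (ln N)] with [ln (ln b) <= ln (ln N)] gives the factor [1 + 1 / ln (ln b)]. *)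
Lemma loss_le_level (R : realType) (b N : R) (q : nat) : 3 <= b -> b <= N ->
  let j := Num.truncn (ln N) in
  [/\ (0 < j)%N, expR j%:R <= N, 0 <= N / ln (ln N) &
   N / ln (ln N) * level q j <= 4 * expR 1 * (1 + 1 / ln (ln b)) * q%:R].
Proof.
move=> b3 bN j.
have b0 : 0 < b by lra.
have N0 : 0 < N by lra.
have lnb : 1 < ln b.
  by rewrite -[ltLHS](expRK 1) ltr_ln ?posrE ?expR_gt0//; have := expR1_lt3 R; lra.
have lnN : ln b <= ln N by rewrite ler_ln.
have llb : 0 < ln (ln b) by exact: ln_gt0.
have llN : ln (ln b) <= ln (ln N) by rewrite ler_ln ?posrE//; lra.
have lnN0 : 0 <= ln N by lra.
have /andP[j1 j2] := truncn_itv lnN0.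
have j0 : (0 < j)%N by rewrite truncn_gt0; lra.
have ejN : expR j%:R <= N by rewrite -[leRHS]lnK ?posrE// ler_expR.
have Nej : N <= expR 1 * expR j%:R.
  by rewrite -expRD -[leLHS]lnK ?posrE// ler_expR nat1r ltW.
split => //; first by rewrite divr_ge0//; lra.
have lnj : ln (j%:R : R) <= ln (ln N) by rewrite ler_ln ?posrE ?ltr0n//; lra.
have lj0 : 0 <= ln (j%:R : R) by rewrite ln_ge0// ler1n.
have Ep := expR_gt0 (j%:R : R).
have L0 : 0 < ln (ln N) by lra.
have -> : N / ln (ln N) * level q j =
    (4 * q%:R) * ((N / expR j%:R) * ((1 + ln j%:R) / ln (ln N))).
  by rewrite /level; field; rewrite !gt_eqF.
have -> : 4 * expR 1 * (1 + 1 / ln (ln b)) * q%:R =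
    (4 * q%:R) * (expR 1 * (1 + 1 / ln (ln b))) by ring.
apply: ler_wpM2l; first by rewrite mulr_ge0.
apply: ler_pM; [by rewrite divr_ge0; lra|by rewrite divr_ge0; lra| |].
  by rewrite ler_pdivrMr.
have h : 1 <= ln (ln N) / ln (ln b) by rewrite ler_pdivlMr// mul1r.
rewrite ler_pdivrMr//.
have -> : (1 + 1 / ln (ln b)) * ln (ln N) = ln (ln N) + ln (ln N) / ln (ln b) by ring.
lra.
Qed.

(* If [q] is the first index with [~ D q w] then at least [q] of the events occur at [w]. *)
Lemma le_event_count (R : realType) (T : Type) (D : nat -> set T) (w : T) (C : R)
  (x : \bar R) : 0 < C ->
  (forall q, ~ D q w -> (x <= (C * q.+1%:R)%:E)%E) ->
  (x <= C%:E * (1 + \sum_(0 <= q <oo) (\1_(D q) w)%:E))%E.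
Proof.
move=> C0 H.
have ge0 q : (0 <= (\1_(D q) w : R)%:E)%E by rewrite lee_fin.
have part n : (forall i, (i < n)%N -> D i w) ->
    (n%:R%:E <= \sum_(0 <= q <oo) (\1_(D q) w : R)%:E)%E.
  move=> Dn; apply: le_trans (nneseries_lim_ge n (fun i _ _ => ge0 i)).
  rewrite sumEFin lee_fin big_mkord -[n in n%:R]card_ord -sumr_const.
  by apply: ler_sum => i _; rewrite indicE mem_set//; exact: Dn.
(* If every event occurs, the count is infinite and the bound is trivial. *)
have [allD|] := pselect (forall q, D q w).
  have -> : (\sum_(0 <= q <oo) (\1_(D q) w : R)%:E = +oo)%E.
    apply/eqyP => a a0; apply: le_trans (part (Num.truncn a).+1 (fun i _ => allD i)).
    by rewrite lee_fin ltW// truncnS_gt.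
  by rewrite addey// gt0_muley ?lte_fin// leey.
move=> /existsNP ex.
have exb : exists q, `[< ~ D q w >] by case: ex => q ?; exists q; apply/asboolP.
case: (ex_minnP exb) => q /asboolP nD min.
apply: (le_trans (H q nD)); rewrite EFinM; apply: lee_wpmul2l; first by rewrite lee_fin ltW.
rewrite -nat1r EFinD leeD2l//; apply: part => i iq.
by apply: contrapT => nDi; have := min i (asboolT nDi); rewrite leqNgt iq.
Qed.

Theorem theorem3 (R : realType) (dT dW : measure_display)
  (T : measurableType dT) (TW : measurableType dW) (P : probability T R)
  (K : nat) (Pk : 'I_K -> probability R R) (mu : 'I_K -> R)
  (psi : R -> R) (lmin lmax : \bar R)
  (W : T -> TW) (A : nat -> T -> 'I_K) (Y : nat -> T -> R)
  (Tstop : T -> nat) (kappa : T -> 'I_K) (tau : T -> nat)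
  (t0 : nat) (b : R) :
  (* arms have finite means mu_k *)
  (forall k, (Pk k).-integrable setT EFin) ->
  (forall k, (\int[Pk k]_y y%:E = (mu k)%:E)%E) ->
  (* Lambda = (lmin, lmax) contains 0 *)
  (lmin < 0%:E)%E -> (0%:E < lmax)%E ->
  (* psi: nonnegative, C^2, strictly convex on Lambda, psi 0 = psi' 0 = 0 *)
  (forall l, in_Lam lmin lmax l -> 0 <= psi l) ->
  (forall l, in_Lam lmin lmax l ->
     [/\ derivable psi l 1, derivable (derive1 psi) l 1 &
         {for l, continuous (derive1 (derive1 psi))}]) ->
  (forall x y s, in_Lam lmin lmax x -> in_Lam lmin lmax y -> x != y ->
     0 < s -> s < 1 ->
     psi (s * x + (1 - s) * y) < s * psi x + (1 - s) * psi y) ->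
  psi 0 = 0 -> derive1 psi 0 = 0 ->
  (* each arm is sub-psi:  log E[e^{l (Y - mu_k)}] <= psi l on Lambda *)
  (forall k l, in_Lam lmin lmax l ->
     (\int[Pk k]_y (expR (l * (y - mu k)))%:E <= (expR (psi l))%:E)%E) ->
  (* the data: W, arms A_t, rewards Y_t are random variables *)
  measurable_fun setT W ->
  (forall t k, measurable [set w | A t w = k]) ->
  (forall t, measurable_fun setT (Y t)) ->
  (* Y_t ~ P_{A_t} independently of the past, given A_t (any sampling rule) *)
  (forall (t : nat) (E : set T) (k : 'I_K) (B : set R),
     filt W A Y t E -> measurable B ->
     P (E `&` [set w | A t w = k] `&` Y t @^-1` B)
       = (P (E `&` [set w | A t w = k]) * Pk k B)%E) ->
  (* Tstop is a stopping time w.r.t. (F_t) *)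
  (forall t, filt W A Y t [set w | Tstop w = t]) ->
  (* kappa and tau are F_Tstop-measurable, tau <= Tstop *)
  stopped_measurable_arm W A Y Tstop kappa ->
  stopped_measurable_nat W A Y Tstop tau ->
  (forall w, (tau w <= Tstop w)%N) ->
  (0 < t0)%N -> 3 <= b ->
  {ae P, forall w, (t0 <= tau w)%N} ->
  {ae P, forall w, forall k, b <= Ncount A k t0 w} ->
  (\int[P]_w
     ((Ncount A (kappa w) (tau w) w / ln (ln (Ncount A (kappa w) (tau w) w)))%:E
      * bregman_loss psi lmin lmax (muhat A Y (kappa w) (tau w) w) (mu (kappa w)))
   <= (4 * expR 1 * (1 + 1 / ln (ln b)))%:E
      * (mutual_info P kappa (stopped_data_event W A Y Tstop) + (5 / 4)%:E))%E.
Proof.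
move=> _ _ lmin0 lmax0 psi_ge0 _ psi_cvx psi0 _ mgf mW mA mY indep stopT mkap mtau
  tauT t0_gt0 b3 tau_ae N_ae.
pose C := 4 * expR 1 * (1 + 1 / ln (ln b)).
have lnb : 1 < ln b.
  by rewrite -[ltLHS](expRK 1) ltr_ln ?posrE ?expR_gt0//; have := expR1_lt3 R; lra.
have C0 : 0 < C.
  by rewrite !mulr_gt0 ?expR_gt0// ltr_pwDl// divr_ge0// ltW// ln_gt0.
pose dev k q t := deviation A Y psi lmin lmax k (mu k) q t.
(* The shift by one avoids index 0, where the level vanishes; the horizon [Tstop] covers every
   [tau <= Tstop]. *)
pose B k q := [set w | dev k q.+1 (Tstop w) w].
pose D q := [set w | B (kappa w) q w].
have data_meas t := data_sigma_measurable W A Y mW mA mY t.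
have filt_meas t := filt_measurable W A Y mW mA mY t.
have mdev k q t : measurable (dev k q t) by apply: (data_meas t); exact: data_sigma_deviation.
have mkappa k : measurable [set w | kappa w = k].
  rewrite (_ : [set w | _] = \bigcup_t ([set w | Tstop w = t] `&` [set w | kappa w = k])).
    by apply: bigcup_measurable => t _; apply: (filt_meas t); exact: mkap.
  by apply/seteqP; split => w /=; [move=> ?; exists (Tstop w)|move=> [t _ []]].
have mB k q : measurable (B k q).
  rewrite (_ : B k q = \bigcup_t ([set w | Tstop w = t] `&` dev k q.+1 t)).
    by apply: bigcup_measurable => t _; apply: measurableI => //; apply: (filt_meas t); exact: stopT.
  apply/seteqP; split => w /=; first by move=> ?; exists (Tstop w).
  by move=> [t _ [/= <-]].
have mD q : measurable (D q).
  rewrite (_ : D q = \bigcup_(k in [set: 'I_K]) (B k q `&` [set w | kappa w = k])).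
    apply: fin_bigcup_measurable => [|k _]; first exact: finite_finset.
    exact: measurableI.
  apply/seteqP; split => w /=; first by move=> ?; exists (kappa w).
  by move=> [k _ [Bw kw]]; rewrite /D/= kw.
have PB k q : fine (P (B k q)) <= 4 * expR (- (4 * q.+1%:R)).
  rewrite -lee_fin fineK ?fin_num_measure//.
  (* The random horizon is absorbed by the increasing union over all horizons, on which the tail
     bound is uniform. *)
  apply: (@le_trans _ _ (P (\bigcup_t dev k q.+1 t))).
    apply: le_measure; rewrite ?inE//; first exact: bigcup_measurable.
    by move=> w Bw; exists (Tstop w).
  apply: measure_bigcup_le => //.
    move=> s t st; apply/subsetPset => w [u [j [us ? ? ?]]]; exists u, j; split => //.
    exact: leq_trans us st.
  move=> t; exact: (deviation_prob W A Y mW mA mY P Pk indep psi lmin lmax k (mu k)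
    lmin0 lmax0 psi_ge0 (mgf k)).
have count n : ((1 + \sum_(i < n) fine (P (D i)))%:E <=
    mutual_info P kappa (stopped_data_event W A Y Tstop) + (5 / 4)%:E)%E.
  apply: (@event_count_mutual_info _ _ _ _ P kappa _ B n) => //; last first.
    by move=> k; apply: (moment_bound R (fun i => fine (P (B k i)))) => i; exact: PB.
  (* On [Tstop = t] an atom coincides with the atom built from the deviations up to the fixed
     horizon [t], an event of [data_sigma t]. *)
  move=> v t.
  exists (event_atom (fun k q => dev k q.+1 t) n v); split.
    apply: (@measurable_event_atom _ (g_sigma_algebraType (data_gen W A Y t))) => k q.
    exact: data_sigma_deviation.
  by apply/seteqP; split => w [/= aw Tw]; split => //= x; rewrite aw /B/= Tw.
have ind_ge0 q w : (0 <= (\1_(D q) w : R)%:E)%E by rewrite lee_fin.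
have mind q : measurable_fun setT (fun w => (\1_(D q) w : R)%:E).
  by apply/measurable_EFinP; exact: measurable_indic.
have sum_ge0 w : (0 <= \sum_(0 <= q <oo) (\1_(D q) w : R)%:E)%E by apply: nneseries_ge0.
have msum : measurable_fun setT (fun w => \sum_(0 <= q <oo) (\1_(D q) w : R)%:E)%E.
  exact: ge0_emeasurable_sum.
apply: (@le_trans _ _ (\int[P]_w (C%:E * (1 + \sum_(0 <= q <oo) (\1_(D q) w)%:E)))%E).
  apply: integral_le_ae.
  - by apply: measurable_funeM; exact: emeasurable_funD.
  - by move=> w; rewrite mule_ge0 ?lee_fin ?(ltW C0)// adde_ge0.
  apply: filterS2 tau_ae N_ae => w tau_ge N_ge.
  apply: le_event_count => // q nD.
  (* Counts grow with time and [t0 <= tau]. *)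
  have bN : b <= Ncount A (kappa w) (tau w) w.
    apply: le_trans (N_ge (kappa w)) _; rewrite /Ncount -(subnKC tau_ge) big_split_ord/= lerDl.
    by apply: sumr_ge0 => i _; rewrite ler0n.
  have [j0 ejN N0 le] := @loss_le_level R b _ q.+1 b3 bN.
  apply: (@le_trans _ _ (Ncount A (kappa w) (tau w) w / ln (ln (Ncount A (kappa w) (tau w) w)) *
     level q.+1 (Num.truncn (ln (Ncount A (kappa w) (tau w) w))))%:E); last by rewrite lee_fin; exact: le.
  rewrite [leRHS]EFinM; apply: lee_wpmul2l; first by rewrite lee_fin.
  rewrite bregman_lossE//; apply: psi_mu_star_le => l lL; rewrite leNgt; apply/negP => lt.
  (* A tilt beating the level at time [tau], in the epoch of the current count, would witness the
     deviation event excluded by [nD]. *)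
  apply: nD; exists (tau w), (Num.truncn (ln (Ncount A (kappa w) (tau w) w : R))); split => //.
  by exists l.
rewrite ge0_integralZl//; last 3 first.
- exact: emeasurable_funD.
- by move=> w _; rewrite adde_ge0.
- by rewrite lee_fin ltW.
apply: lee_wpmul2l; first by rewrite lee_fin ltW.
rewrite ge0_integralD// integral_cst// mul1e integral_nneseries//.
rewrite [X in (X + _ <= _)%E](_ : _ = 1%E); last exact: probability_setT.
(* With the finite term 1 moved across, the series is bounded through its partial sums, each
   controlled by [count n]. *)
rewrite -leeBrDl//.
apply: lime_le; first by apply: is_cvg_nneseries => q _ _; exact: integral_ge0.
apply: nearW => n; rewrite leeBrDl// big_mkord; apply: le_trans (count n).
rewrite EFinD leeD2l// -sumEFin; apply: lee_sum => i _.
by rewrite integral_indic// setIT fineK// fin_num_measure.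
Qed.
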